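(* Let $M^5\subset\mathbb C^4$ be a maximally minimal CR-generic real analytic submanifold with frame $\{\overline{\mathcal S},\mathcal S,\mathcal T,\overline{\mathcal L},\mathcal L\}$. There are six complex-valued functions $P,Q,R,A,B,C$ defined on $M$ such that $$[\mathcal L,\mathcal S]=P\,\mathcal T+Q\,\mathcal S+R\,\overline{\mathcal S},\qquad [\overline{\mathcal L},\mathcal S]=A\,\mathcal T+B\,\mathcal S+C\,\overline{\mathcal S},$$ $$[\mathcal L,\overline{\mathcal S}]=\overline A\,\mathcal T+\overline C\,\mathcal S+\overline B\,\overline{\mathcal S},\qquad [\overline{\mathcal L},\overline{\mathcal S}]=\overline P\,\mathcal T+\overline R\,\mathcal S+\overline Q\,\overline{\mathcal S}.$$ Moreover, the two brackets $[\overline{\mathcal L},\mathcal S]=[\mathcal L,\overline{\mathcal S}]$ are real and equal. In particular, $A$ is a real-valued function and $C=\overline B$.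
   Context: $M^5\subset\mathbb C^4$ is a local real analytic CR-generic submanifold of codimension $3$, in coordinates $z=x+iy$, $w_j=u_j+iv_j$ ($j=1,2,3$), given near the origin as a graph $v_j=\varphi_j(x,y,u_1,u_2,u_3)$ with $\varphi_j(0)=0$, $d\varphi_j(0)=0$; $(x,y,u_1,u_2,u_3)$ are coordinates on $M$. $\overline{\mathcal L}$ is the unique local generator of $T^{0,1}M$ whose intrinsic expression is $\partial_{\overline z}$ plus a combination of $\partial_{u_1},\partial_{u_2},\partial_{u_3}$; $\mathcal L$ is its conjugate. Put $\mathcal T:=i[\mathcal L,\overline{\mathcal L}]$ (real), $\mathcal S:=[\mathcal L,\mathcal T]$, $\overline{\mathcal S}:=[\overline{\mathcal L},\mathcal T]$. Maximally minimal means that $\{\overline{\mathcal S},\mathcal S,\mathcal T,\overline{\mathcal L},\mathcal L\}$ is a frame for $\mathbb C\otimes_{\mathbb R}TM$. *)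

(* Defs.v *)
From HB Require Import structures.
From mathcomp Require Import all_boot all_order all_algebra.
From mathcomp Require Import finmap.
From mathcomp Require Import all_classical all_reals all_analysis.
From mathcomp.analysis.showcase Require Import summability.
From mathcomp Require Import complex.

Set Implicit Arguments.
Unset Strict Implicit.
Unset Printing Implicit Defensive.

Import Order.TTheory GRing.Theory Num.Theory.
Import numFieldNormedType.Exports.

Local Open Scope classical_set_scope.
Local Open Scope ring_scope.
Local Open Scope complex_scope.

(* Convergence along [totally] is unconditional (equivalently, absolute). *)
Definition analytic_at (R : realType) (n : nat) (f : 'rV[R]_n -> R)
    (p : 'rV[R]_n) : Prop :=
  exists (c : {ffun 'I_n -> nat} -> R) (r : R), 0 < r /\
    forall h : 'rV[R]_n, (forall i, `|h 0 i| < r) ->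
      partial_sum (fun a => c a * \prod_(i < n) h 0 i ^+ a i) @ totally
        --> f (p + h).

Definition partial (R : realType) (n : nat) (k : 'I_n)
    (f : 'rV[R]_n -> R[i]) (p : 'rV[R]_n) : R[i] :=
  ('D_(delta_mx 0 k) (fun q => complex.Re (f q)) p)
    +i* ('D_(delta_mx 0 k) (fun q => complex.Im (f q)) p).

(* A complexified tangent vector X at p, given by its components on the
   coordinate basis of R^n, acting as a derivation. *)
Definition vderive (R : realType) (n : nat) (X : 'rV[R[i]]_n)
    (f : 'rV[R]_n -> R[i]) (p : 'rV[R]_n) : R[i] :=
  \sum_(k < n) X 0 k * partial k f p.

Definition vfield (R : realType) (n : nat) : Type := 'rV[R]_n -> 'rV[R[i]]_n.

Definition bracket (R : realType) (n : nat) (X Y : vfield R n) : vfield R n :=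
  fun p => \row_(k < n) (vderive (X p) (fun q => Y q 0 k) p
                         - vderive (Y p) (fun q => X q 0 k) p).

Definition conjf (R : realType) (n : nat) (X : vfield R n) : vfield R n :=
  fun p => map_mx (@conjc R) (X p).

(* Points of R^5 are (x, y, u_1, u_2, u_3); points of C^4 are
   (z, w_1, w_2, w_3). *)
Definition xix : 'I_5 := lshift 3 (0 : 'I_2).
Definition yix : 'I_5 := lshift 3 (1 : 'I_2).
Definition uix (j : 'I_3) : 'I_5 := rshift 2 j.

Definition graph (R : realType) (phi : 'I_3 -> 'rV[R]_5 -> R)
    (p : 'rV[R]_5) : 'rV[R[i]]_4 :=
  row_mx (const_mx (p 0 xix +i* p 0 yix) : 'rV_1)
         (\row_(j < 3) (p 0 (uix j) +i* phi j p)).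

(* T_qM at q = graph phi p, the tangent space of C^4 being identified
   with C^4 itself. *)
Definition tangent (R : realType) (phi : 'I_3 -> 'rV[R]_5 -> R)
    (p : 'rV[R]_5) : set 'rV[R[i]]_4 :=
  [set V | exists t : 'rV[R]_5,
     V = \row_(m < 4) \sum_(k < 5)
           (t 0 k)%:C * partial k (fun q => graph phi q 0 m) p].

(* TM + J TM = TC^4 *)
Definition CR_generic (R : realType) (phi : 'I_3 -> 'rV[R]_5 -> R)
    (p : 'rV[R]_5) : Prop :=
  forall V : 'rV[R[i]]_4, exists V1 V2 : 'rV[R[i]]_4,
    [/\ tangent phi p V1, tangent phi p V2 & V = V1 + 'i%C *: V2].

(* A pair (a, b) stands for the element
   sum_m a_m d/d(Re zeta_m) + b_m d/d(Im zeta_m)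
   of the complexified tangent space of C^4, where zeta = (z, w). *)
Notation CTC4 R := ('rV[R[i]]_4 * 'rV[R[i]]_4)%type.

Definition Jmap (R : realType) (V : CTC4 R) : CTC4 R := (- V.2, V.1).

Definition push (R : realType) (phi : 'I_3 -> 'rV[R]_5 -> R)
    (p : 'rV[R]_5) (X : 'rV[R[i]]_5) : CTC4 R :=
  (\row_(m < 4) vderive X (fun q => (complex.Re (graph phi q 0 m))%:C) p,
   \row_(m < 4) vderive X (fun q => (complex.Im (graph phi q 0 m))%:C) p).

(* T^{0,1}M, intrinsically: the vectors of the complexified TM on which the
   complex structure of C^4 is multiplication by -i. *)
Definition T01 (R : realType) (phi : 'I_3 -> 'rV[R]_5 -> R)
    (p : 'rV[R]_5) : set 'rV[R[i]]_5 :=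
  [set X | Jmap (push phi p X) = - 'i%C *: push phi p X].

(* X spans T^{0,1}M over U, and X = d/d(zbar) + (combination of the d/du_j),
   with d/d(zbar) = (d/dx + i d/dy) / 2. *)
Definition T01_generator (R : realType) (phi : 'I_3 -> 'rV[R]_5 -> R)
    (U : set 'rV[R]_5) (X : vfield R 5) : Prop :=
  forall p, U p ->
    [/\ X p 0 xix = 2^-1, X p 0 yix = 'i%C / 2
      & T01 phi p = [set Y | exists a : R[i], Y = a *: X p]].

Section Frame.
Context (R : realType) (Lbar : vfield R 5).

Definition Lfield : vfield R 5 := conjf Lbar.
Definition Tfield : vfield R 5 := fun p => 'i%C *: bracket Lfield Lbar p.
Definition Sfield : vfield R 5 := bracket Lfield Tfield.
Definition Sbarfield : vfield R 5 := bracket Lbar Tfield.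

Definition maximally_minimal (U : set 'rV[R]_5) : Prop :=
  forall p, U p ->
    basis_of {:'rV[R[i]]_5}
      [:: Sbarfield p; Sfield p; Tfield p; Lbar p; Lfield p].
End Frame.

(* Main.v *)
Require Import Defs.
From HB Require Import structures.
From mathcomp Require Import all_boot all_order all_algebra finmap.
From mathcomp Require Import all_classical all_reals all_analysis.
From mathcomp.analysis.showcase Require Import summability.
From mathcomp Require Import complex ring lra.
Import Order.TTheory GRing.Theory Num.Theory.
Import numFieldNormedType.Exports.
Local Open Scope classical_set_scope.
Local Open Scope ring_scope.
Local Open Scope complex_scope.
Set Implicit Arguments.
Unset Strict Implicit.
Unset Printing Implicit Defensive.

(* Writing the components of Lbar along the u_j as a column vector a, the
   condition T^{0,1} becomes the linear system (i - phi_u) a =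
   (phi_x + i phi_y) / 2, whose matrix is invertible because T^{0,1}M is a line
   transverse to the d/du_j.  By Cramer's rule the components of Lbar are smooth,
   so the Jacobi identity holds for the fields built from it.  Applied to
   Lbar, L, T, with [Lbar, L] = i T, it gives [Lbar, S] = [L, Sbar], and this
   bracket is real since conjugation exchanges L with Lbar and S with Sbar.  The
   d/dx and d/dy components of L and Lbar are constant, so all brackets lie in
   the span of the d/du_j, of which T, S, Sbar is a basis at each point. *)

(* [T01_generator] prescribes [Lbar] pointwise and carries no regularity, while [bracket] is built
   from directional derivatives, which have some value even where the limit does not exist. Before
   any rule of calculus applies to the fields, their components must be shown differentiable, and
   repeatedly so, since the brackets with [S] involve iterated derivatives of [Lbar]. Only
   derivatives along the coordinate axes occur, so it suffices to differentiate power series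
   termwise: the differentiated series converges on the same polydisc, and its coefficients show at
   once that second derivatives commute. Convergence along finite index sets is absolute, and a
   bound on the absolute sums at a slightly larger point controls every remainder. The coefficient
   functions are coordinates in the frame, hence determined at each point. Comparing the expansion
   of a bracket with its conjugate is what turns the equality of the two brackets into $A=\overline
   A$ and $C=\overline B$. *)
#[local] Existing Instance totally_filter.

(** * Unordered sums *)

Section UnorderedSums.
Context (R : realType) (I : choiceType).
Implicit Types (x y : I -> R) (A B : {fset I}) (l m : R).

Lemma partial_sumE x A : partial_sum x A = \sum_(i <- A) x i.
Proof. by rewrite /partial_sum big_seq_fsetE. Qed.

Lemma cvg_totallyP x l : partial_sum x @ totally --> l <->
  forall e, 0 < e -> exists A, forall B, (A `<=` B)%fset ->
    `|l - \sum_(i <- B) x i| < e.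
Proof.
split=> [/cvgrPdist_lt h e e0|h].
  by have [A _ AP] := h e e0; exists A => B AB; rewrite -partial_sumE; apply: AP.
apply/cvgrPdist_lt => e e0; have [A AP] := h e e0.
by exists A => // B /= AB; rewrite partial_sumE; apply: AP.
Qed.

Lemma big_fsetD_sub x A B : (A `<=` B)%fset ->
  \sum_(i <- B) x i = \sum_(i <- A) x i + \sum_(i <- (B `\` A)%fset) x i.
Proof.
move=> AB; rewrite (big_fsetID _ (mem A)) /=; congr (_ + _).
- have -> : [fset i in B | i \in A]%fset = A; last by [].
  apply/fsetP => i; rewrite !inE /= andbC.
  by case iA : (i \in A) => //=; apply: (fsubsetP AB).
- congr (\sum_(i <- enum_fset _) x i).
  by apply/fsetP => i; rewrite !inE /= andbC.
Qed.

Lemma ler_big_fset x A B : (forall i, 0 <= x i) -> (A `<=` B)%fset ->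
  \sum_(i <- A) x i <= \sum_(i <- B) x i.
Proof.
by move=> x0 /(big_fsetD_sub x) ->; rewrite lerDl sumr_ge0.
Qed.

(** Once the sums over supersets of some finite [A] lie within 1 of [l], every finite set disjoint
    from [A] has a sum of modulus at most 2. Splitting such a set by the sign of [x] bounds its
    absolute sum by 2 + 2, whence the constant 4. *)
Lemma cvg_totally_bounded x l : partial_sum x @ totally --> l ->
  exists M, forall B, \sum_(i <- B) `|x i| <= M.
Proof.
move=> /cvg_totallyP/(_ 1 ltr01)[A AP].
have tail K : [disjoint K & A]%fset -> `|\sum_(i <- K) x i| <= 2.
  move=> KA; have := AP A (fsubset_refl _).
  have := AP (A `|` K)%fset (fsubsetUl _ _).
  rewrite (big_fsetD_sub x (fsubsetUl A K)).
  have -> : ((A `|` K) `\` A = K)%fset.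
    apply/fsetP => i; rewrite !inE; case: (boolP (i \in A)) => //= iA.
    by apply/esym/negbTE; apply: contraL iA; apply/fdisjointP.
  move=> h1 h2; have := ler_normB (l - \sum_(i <- A) x i)
    (l - (\sum_(i <- A) x i + \sum_(i <- K) x i)).
  by rewrite opprB [X in `|X|](_ : _ = \sum_(i <- K) x i); [lra|ring].
exists (\sum_(i <- A) `|x i| + 4) => B.
apply: (@le_trans _ _ (\sum_(i <- (A `|` B)%fset) `|x i|)).
  by apply: ler_big_fset => // ; exact: fsubsetUr.
rewrite (big_fsetD_sub _ (fsubsetUl A B)) lerD2l.
set K := (_ `\` _)%fset.
have KA : [disjoint K & A]%fset.
  by apply/fdisjointP => i; rewrite inE => /andP[].
rewrite (big_fsetID _ (fun i => 0 <= x i)) /=.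
have h1 := tail [fset i in K | 0 <= x i]%fset.
have h2 := tail [fset i in K | ~~ (0 <= x i)]%fset.
have -> : (4 : R) = 2 + 2 by lra.
apply: lerD.
- rewrite (eq_big_seq x); last first.
    by move=> i; rewrite !inE /= => /andP[_] /ger0_norm.
  apply: le_trans (ler_norm _) (h1 _).
  by apply/fdisjointP => i; rewrite !inE /= => /andP[/andP[]].
- rewrite (eq_big_seq (fun i => - x i)); last first.
    by move=> i; rewrite !inE /= -ltNge => /andP[_] /ltr0_norm.
  rewrite sumrN; apply: le_trans (ler_norm _) _; rewrite normrN; apply: h2.
  by apply/fdisjointP => i; rewrite !inE /= => /andP[/andP[]].
Qed.

Lemma nneg_bounded_cvg_totally x M : (forall i, 0 <= x i) ->
  (forall B, \sum_(i <- B) x i <= M) ->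
  exists l : R, partial_sum x @ totally --> l.
Proof.
move=> x0 xM; pose E := [set \sum_(i <- B) x i | B in [set: {fset I}]].
have hE : has_sup E.
  split; first by exists (\sum_(i <- fset0) x i), fset0.
  by exists M => _ [B _ <-].
exists (sup E); apply/cvg_totallyP => e e0.
have [_ [A _ <-] hA] := sup_adherent e0 hE.
exists A => B AB.
have hB : \sum_(i <- B) x i <= sup E by apply: ub_le_sup; [case: hE | exists B].
rewrite ger0_norm ?subr_ge0//.
by have := ler_big_fset x0 AB; lra.
Qed.

Lemma cvg_totally_eq x y l : x =1 y ->
  partial_sum x @ totally --> l -> partial_sum y @ totally --> l.
Proof. by move=> /funext ->. Qed.

Lemma cvg_totallyD x y l m : partial_sum x @ totally --> l ->
  partial_sum y @ totally --> m ->
  partial_sum (fun i => x i + y i) @ totally --> l + m.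
Proof.
move=> xl ym; have -> : partial_sum (fun i => x i + y i) =
  partial_sum x \+ partial_sum y.
  by apply/funext => A /=; rewrite !partial_sumE big_split.
exact: cvgD.
Qed.

Lemma cvg_totallyZ x l c : partial_sum x @ totally --> l ->
  partial_sum (fun i => c * x i) @ totally --> c * l.
Proof.
move=> xl; have -> : partial_sum (fun i => c * x i) =
  (fun A => c * partial_sum x A).
  by apply/funext => A /=; rewrite !partial_sumE mulr_sumr.
exact: cvgMr.
Qed.

(** Write [x] as (|x| + x) - |x|, a difference of nonnegative families with bounded sums. *)
Lemma bounded_cvg_totally x M : (forall B, \sum_(i <- B) `|x i| <= M) ->
  exists l : R, partial_sum x @ totally --> l.
Proof.
move=> xM.
have [l1 h1] : exists l : R, partial_sum (fun i => `|x i|) @ totally --> l.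
  exact: nneg_bounded_cvg_totally xM.
have [l2 h2] : exists l : R, partial_sum (fun i => `|x i| + x i) @ totally --> l.
  apply: (@nneg_bounded_cvg_totally _ (M + M)) => [i|B].
    by have := ler_norm (- x i); rewrite normrN; lra.
  rewrite big_split lerD//=; apply: le_trans (xM B); apply: ler_sum => i _.
  exact: ler_norm.
exists (l2 + (-1) * l1).
apply: cvg_totally_eq (cvg_totallyD h2 (cvg_totallyZ (c := -1) h1)) => i /=.
by ring.
Qed.

Lemma cvg_totally_le x y l M : partial_sum x @ totally --> l ->
  (forall i, `|x i| <= y i) -> (forall B, \sum_(i <- B) y i <= M) ->
  `|l| <= M.
Proof.
move=> xl xy yM; apply/ler_addgt0Pl => e e0.
move/cvg_totallyP: xl => /(_ e e0)[A /(_ A (fsubset_refl _))] h.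
have : `|\sum_(i <- A) x i| <= M.
  apply: le_trans (yM A); apply: le_trans (ler_norm_sum _ _ _) _.
  exact: ler_sum.
have := ler_normD (l - \sum_(i <- A) x i) (\sum_(i <- A) x i).
by rewrite subrK; lra.
Qed.

(** The index [i] lies outside the image of [g] exactly when [g (h i) != i], so the reindexing drops
    only zero terms. In a differentiated series [g] raises an exponent by one, and the dropped terms
    are those in which the variable does not occur. *)
Lemma cvg_totally_reindex x l (g h : I -> I) : cancel g h ->
  (forall i, g (h i) != i -> x i = 0) ->
  partial_sum x @ totally --> l -> partial_sum (x \o g) @ totally --> l.
Proof.
move=> gK x0 /cvg_totallyP xl; apply/cvg_totallyP => e e0.
have [A AP] := xl e e0; exists [fset h i | i in A]%fset => B hAB.
have -> : \sum_(i <- B) (x \o g) i = \sum_(i <- [fset g i | i in B]%fset) x i.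
  by rewrite big_imfset //= => i j _ _ /(can_inj gK).
have sub : ([fset g i | i in B] `<=` [fset g i | i in B] `|` A)%fset.
  exact: fsubsetUl.
have <- : \sum_(i <- ([fset g i | i in B] `|` A)%fset) x i =
    \sum_(i <- [fset g i | i in B]%fset) x i; last exact/AP/fsubsetUr.
rewrite (big_fsetD_sub x sub) [X in _ + X]big1_seq ?addr0//= => i.
rewrite !inE => /andP[iB /orP[iB'|iA]]; first by rewrite iB' in iB.
(* An index [i] of [A] in the image of [g] is [g (h i)] with [h i] in [B], so it already belongs to
   the image of [B]. *)
apply: x0; apply: contra iB => /eqP <-.
by apply: in_imfset; apply: (fsubsetP hAB); apply: in_imfset.
Qed.

End UnorderedSums.

(** * Termwise differentiation of power series *)

Section PowerTaylor.
Context (R : realType).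
Implicit Types (x t X d : R) (m : nat).

(** In the binomial expansion each term with $t^j$, $j\ge 1$, satisfies $|t|^j\le(|t|/d)\,d^j$, and
    the remaining factors have nonnegative coefficients, so $|x|$ may be replaced by $X$. *)
Lemma expr_diff_bound x t X d m : `|x| <= X -> 0 < d -> `|t| <= d ->
  `|(x + t) ^+ m - x ^+ m| <= `|t| / d * ((X + d) ^+ m - X ^+ m).
Proof.
move=> xX d0 td.
have X0 : 0 <= X by apply: le_trans xX.
elim: m => [|m IH]; first by rewrite !expr0 !subrr normr0 mulr0.
have -> : (x + t) ^+ m.+1 - x ^+ m.+1 =
  x * ((x + t) ^+ m - x ^+ m) + t * (x + t) ^+ m by rewrite !exprS; ring.
have -> : `|t| / d * ((X + d) ^+ m.+1 - X ^+ m.+1) =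
  X * (`|t| / d * ((X + d) ^+ m - X ^+ m)) + `|t| * (X + d) ^+ m.
  by rewrite !exprS; field; rewrite gt_eqF.
apply: le_trans (ler_normD _ _) _; rewrite !normrM normrX lerD//.
  by apply: ler_pM.
rewrite ler_wpM2l// lerXn2r ?nnegrE//; first by lra.
by apply: le_trans (ler_normD _ _) _; lra.
Qed.

(* The right-hand side is the same Taylor remainder at X with increment d, which
   makes the induction on m go through. *)
Lemma expr_taylor_bound x t X d m : `|x| <= X -> 0 < d -> `|t| <= d ->
  `|(x + t) ^+ m - x ^+ m - t * (m%:R * x ^+ m.-1)| <=
  (`|t| / d) ^+ 2 * ((X + d) ^+ m - X ^+ m - d * (m%:R * X ^+ m.-1)).
Proof.
move=> xX d0 td.
have X0 : 0 <= X by apply: le_trans xX.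
elim: m => [|m IH]; first by rewrite !expr0 !mul0r !mulr0 !subrr normr0 mulr0.
have deriv (y s : R) : s * (m.+1%:R * y ^+ m) =
    y * (s * (m%:R * y ^+ m.-1)) + s * y ^+ m.
  by case: m {IH} => [|m]; rewrite ?expr0 /= ?exprS -?natr1; ring.
rewrite /= !deriv.
have -> : (x + t) ^+ m.+1 - x ^+ m.+1 -
     (x * (t * (m%:R * x ^+ m.-1)) + t * x ^+ m) =
  x * ((x + t) ^+ m - x ^+ m - t * (m%:R * x ^+ m.-1)) +
  t * ((x + t) ^+ m - x ^+ m) by rewrite !exprS; ring.
have -> : (`|t| / d) ^+ 2 * ((X + d) ^+ m.+1 - X ^+ m.+1 -
     (X * (d * (m%:R * X ^+ m.-1)) + d * X ^+ m)) =
  X * ((`|t| / d) ^+ 2 * ((X + d) ^+ m - X ^+ m - d * (m%:R * X ^+ m.-1))) +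
  `|t| * (`|t| / d * ((X + d) ^+ m - X ^+ m)).
  by rewrite !exprS; field; rewrite gt_eqF.
apply: le_trans (ler_normD _ _) _; rewrite !normrM lerD//.
  by apply: ler_pM.
by rewrite ler_wpM2l// expr_diff_bound.
Qed.

Lemma expr_taylor_le x t X d m : `|x| <= X -> 0 < d -> `|t| <= d ->
  `|(x + t) ^+ m - x ^+ m - t * (m%:R * x ^+ m.-1)| <=
  (`|t| / d) ^+ 2 * (X + d) ^+ m.
Proof.
move=> xX d0 td; apply: le_trans (expr_taylor_bound m xX d0 td) _.
have X0 : 0 <= X by apply: le_trans xX.
rewrite ler_wpM2l ?exprn_ge0 ?divr_ge0 ?(ltW d0)//.
have : 0 <= X ^+ m by exact: exprn_ge0.
have : 0 <= d * (m%:R * X ^+ m.-1).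
  by rewrite !mulr_ge0 ?exprn_ge0// ltW.
lra.
Qed.

(** A Cauchy estimate: the Taylor remainder of the power at [X] with increment [d] is nonnegative,
    which is read off from [expr_taylor_bound] with [t := d]. *)
Lemma expr_deriv_le x X d m : `|x| <= X -> 0 < d ->
  `|m%:R * x ^+ m.-1| <= d^-1 * (X + d) ^+ m.
Proof.
move=> xX d0.
have X0 : 0 <= X by apply: le_trans xX.
rewrite normrM normrX ger0_norm//.
apply: (@le_trans _ _ (m%:R * X ^+ m.-1)).
  by rewrite ler_wpM2l// lerXn2r ?nnegrE.
rewrite ler_pdivlMl//.
have dd : `|d| <= d by rewrite gtr0_norm.
have XX : `|X| <= X by rewrite ger0_norm.
have := le_trans (normr_ge0 _) (expr_taylor_bound m XX d0 dd).
rewrite gtr0_norm// divff ?gt_eqF// expr1n mul1r.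
have : 0 <= X ^+ m by exact: exprn_ge0.
lra.
Qed.

End PowerTaylor.

(** * Power series in several variables and their partial derivatives *)

Section PowerSeries.
Context (R : realType) (n : nat).
Notation midx := {ffun 'I_n -> nat}.
Implicit Types (a b : midx) (h : 'rV[R]_n) (k : 'I_n) (c : midx -> R).

Definition monom a h : R := \prod_(i < n) h 0 i ^+ a i.

(** The formal partial derivative of [monom a]. When [a k = 0] the truncated predecessor is
    harmless, because the factor [(a k)%:R] vanishes. *)
Definition dmonom k a h : R :=
  (a k)%:R * h 0 k ^+ (a k).-1 * \prod_(i < n | i != k) h 0 i ^+ a i.

Definition mincr k a : midx := [ffun i => (a i + (i == k))%N].
Definition mdecr k a : midx := [ffun i => (a i - (i == k))%N].

Definition dcoef k c : midx -> R := fun a => (a k).+1%:R * c (mincr k a).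

Lemma dcoef_comm i j c : dcoef i (dcoef j c) =1 dcoef j (dcoef i c).
Proof.
move=> a; rewrite /dcoef.
have -> : mincr j (mincr i a) = mincr i (mincr j a).
  by apply/ffunP => l; rewrite !ffunE addnAC.
rewrite !ffunE (eq_sym j i); case: eqVneq => [->//|_].
by rewrite !addn0 mulrCA.
Qed.

Lemma mincrK k : cancel (mincr k) (mdecr k).
Proof. by move=> a; apply/ffunP => i; rewrite !ffunE addnK. Qed.

(** The truncated subtraction in [mdecr] is not undone by [mincr] only when [a k = 0]. This is the
    vanishing hypothesis required by [cvg_totally_reindex]. *)
Lemma dmonom_eq0 k a h : mincr k (mdecr k a) != a -> dmonom k a h = 0.
Proof.
rewrite /dmonom; case E : (a k) => [|m]; first by rewrite !mul0r.
case/eqP; apply/ffunP => i; rewrite !ffunE subnK//.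
by case: eqP => //= ->; rewrite E.
Qed.

Lemma dmonom_mincr k a h : dmonom k (mincr k a) h = (a k).+1%:R * monom a h.
Proof.
rewrite /dmonom /monom [in RHS](bigD1 k)//= !ffunE eqxx addn1 mulrA.
congr (_ * _); apply: eq_bigr => i ik.
by rewrite ffunE (negbTE ik) addn0.
Qed.

Lemma monom_shift k a h t : monom a (h + t *: delta_mx 0 k) =
  (h 0 k + t) ^+ a k * \prod_(i < n | i != k) h 0 i ^+ a i.
Proof.
rewrite /monom (bigD1 k)//= !mxE !eqxx mulr1; congr (_ * _).
by apply: eq_bigr => i ik; rewrite !mxE (negbTE ik) andbF mulr0 addr0.
Qed.

(** The coordinates are made nonnegative so that the value of a monomial here bounds its modulus at
    every point whose coordinates differ from those of [h] by at most [d]. *)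
Definition enlarge h (d : R) : 'rV[R]_n := \row_i (`|h 0 i| + d).

Lemma monom_enlarge a h d k : monom a (enlarge h d) =
  (`|h 0 k| + d) ^+ a k * \prod_(i < n | i != k) enlarge h d 0 i ^+ a i.
Proof. by rewrite /monom (bigD1 k)//= mxE. Qed.

Lemma monom_enlarge_ge0 a h d : 0 < d -> 0 <= monom a (enlarge h d).
Proof.
move=> d0; apply: prodr_ge0 => i _; rewrite mxE exprn_ge0//.
by rewrite addr_ge0// ltW.
Qed.

Lemma prod_enlarge_le a h d k : 0 < d ->
  `|\prod_(i < n | i != k) h 0 i ^+ a i| <=
  \prod_(i < n | i != k) enlarge h d 0 i ^+ a i.
Proof.
move=> d0; rewrite normr_prod; apply: ler_prod => i _.
rewrite normr_ge0 normrX lerXn2r ?nnegrE// mxE ?lerDl ?addr_ge0// ltW//.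
Qed.

Lemma dmonom_le a h d k : 0 < d ->
  `|dmonom k a h| <= d^-1 * monom a (enlarge h d).
Proof.
move=> d0; rewrite /dmonom normrM (monom_enlarge _ _ _ k) mulrA.
by apply: ler_pM => //; [exact: expr_deriv_le | exact: prod_enlarge_le].
Qed.

Lemma monom_taylor_le a h d k t : 0 < d -> `|t| <= d ->
  `|monom a (h + t *: delta_mx 0 k) - monom a h - t * dmonom k a h| <=
  (`|t| / d) ^+ 2 * monom a (enlarge h d).
Proof.
move=> d0 td; rewrite (monom_enlarge _ _ _ k) monom_shift.
rewrite /dmonom [monom a h](bigD1 k)//=.
rewrite [t * _]mulrA -!mulrBl normrM mulrA.
by apply: ler_pM => //; [exact: expr_taylor_le | exact: prod_enlarge_le].
Qed.

Definition polydisc (r : R) : set 'rV[R]_n := [set h | forall i, `|h 0 i| < r].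

Definition has_power_series (f : 'rV[R]_n -> R) p c r :=
  forall h, polydisc r h ->
    partial_sum (fun a => c a * monom a h) @ totally --> f (p + h).

(** Finitely many strict inequalities leave a margin: [d] is half the gap between [r] and the
    largest coordinate modulus. The default 0 of the maximum covers dimension zero. *)
Lemma polydisc_enlarge r h : 0 < r -> polydisc r h ->
  exists2 d, 0 < d & polydisc r (enlarge h d).
Proof.
move=> r0 hr; pose m := \big[Num.max/0]_(i < n) `|h 0 i|.
have mr : m < r by apply: (big_ind (fun x => x < r)) => // x y xr yr;
  rewrite gt_max xr yr.
have hm i : `|h 0 i| <= m by apply: le_bigmax_cond.
exists ((r - m) / 2); first lra.
move=> i; rewrite mxE ger0_norm; have := hm i; have := normr_ge0 (h 0 i); lra.
Qed.

Lemma polydisc_shift h d k t r : `|t| <= d -> polydisc r (enlarge h d) ->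
  polydisc r (h + t *: delta_mx 0 k).
Proof.
move=> td hr i; apply: le_lt_trans (hr i).
rewrite !mxE; apply: le_trans (ler_normD _ _) _.
apply: le_trans (ler_norm _); rewrite lerD2l normrM.
case: (_ && _); rewrite ?normr0 ?normr1 ?mulr0 ?mulr1//.
exact: le_trans td.
Qed.

(* All remainders are dominated by the series of absolute values at the point
   [enlarge h d], which still lies in the polydisc. *)
Lemma power_series_derive f p c r h k : 0 < r -> has_power_series f p c r ->
  polydisc r h -> is_derive (p + h) (delta_mx 0 k) f ('D_(delta_mx 0 k) f (p + h)) /\
    partial_sum (fun a => dcoef k c a * monom a h) @ totally -->
      'D_(delta_mx 0 k) f (p + h).
Proof.
move=> r0 fc hr.
have [d d0 hd] := polydisc_enlarge r0 hr.
set H := enlarge h d in hd.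
have [M hM] := cvg_totally_bounded (fc _ hd).
have cM (B : {fset midx}) : \sum_(a <- B) `|c a| * monom a H <= M.
  apply: le_trans (hM B); apply: ler_sum => a _.
  by rewrite normrM (@ger0_norm _ (monom _ _))// monom_enlarge_ge0.
have [l hl] : exists l : R,
    partial_sum (fun a => c a * dmonom k a h) @ totally --> l.
  apply: (@bounded_cvg_totally _ _ _ (d^-1 * M)) => B.
  apply: (@le_trans _ _ (d^-1 * \sum_(a <- B) `|c a| * monom a H)).
    rewrite mulr_sumr; apply: ler_sum => a _.
    by rewrite normrM mulrCA ler_wpM2l// dmonom_le.
  by rewrite ler_wpM2l// invr_ge0 ltW.
have est t : `|t| <= d ->
    `|f (p + (h + t *: delta_mx 0 k)) - f (p + h) - t * l| <= (`|t| / d) ^+ 2 * M.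
  move=> td; have hdt := polydisc_shift k td hd.
  apply: (@cvg_totally_le _ _
     (fun a => c a * (monom a (h + t *: delta_mx 0 k) - monom a h -
                      t * dmonom k a h))
     (fun a => (`|t| / d) ^+ 2 * (`|c a| * monom a H))).
  - have := cvg_totallyD (cvg_totallyD (fc _ hdt) (cvg_totallyZ (c := -1) (fc _ hr)))
      (cvg_totallyZ (c := - t) hl).
    rewrite mulN1r mulNr; apply: cvg_totally_eq => a /=; ring.
  - by move=> a; rewrite normrM [leRHS]mulrCA ler_wpM2l// monom_taylor_le.
  - by move=> B; rewrite -mulr_sumr ler_wpM2l// exprn_ge0// divr_ge0// ltW.
have M0 : 0 <= M by apply: le_trans (hM fset0); rewrite big_seq_fset0.
have fD : (fun t : R => t^-1 *: ((f \o shift (p + h)) (t *: delta_mx 0 k) - f (p + h)))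
    @ 0^' --> (l : R).
  apply/cvgrPdist_le => e e0.
  (* The remainder gives an error at most $|t|M/d^2$ in the difference quotient. The denominator
     [M + 1] keeps the threshold meaningful when [M = 0]. *)
  have e' : 0 < Num.min d (e * d ^+ 2 / (M + 1)).
    by rewrite lt_min d0 divr_gt0 ?mulr_gt0 ?exprn_gt0//; lra.
  near=> t.
  have t0 : t != 0 by near: t; exact: nbhs_dnbhs_neq.
  have : `|t| < Num.min d (e * d ^+ 2 / (M + 1)).
    by near: t; apply: dnbhs0_lt.
  rewrite lt_min => /andP[td te].
  have := est t (ltW td).
  rewrite /= (addrC _ (p + h)) addrA => hest.
  have -> : l - t^-1 *: (f (p + h + t *: delta_mx 0 k) - f (p + h)) =
     - t^-1 * (f (p + h + t *: delta_mx 0 k) - f (p + h) - t * l).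
    by rewrite /GRing.scale /=; field.
  rewrite normrM normrN normfV ler_pdivrMl ?normr_gt0//.
  apply: le_trans hest _.
  have -> : (`|t| / d) ^+ 2 * M = `|t| * (`|t| * M / d ^+ 2).
    by field; rewrite gt_eqF.
  rewrite ler_wpM2l// ler_pdivrMr ?exprn_gt0//.
  move: te; rewrite ltr_pdivlMr; last by lra.
  by have := normr_ge0 t; nra.
have Dl : 'D_(delta_mx 0 k) f (p + h) = l by exact/cvg_lim.
split.
  by apply: DeriveDef => //; apply/cvg_ex; exists l.
(* The derivative is so far the sum of the terms [c a * dmonom k a h]; raising the exponent of
   variable [k] rewrites it as a power series. *)
rewrite Dl; apply: cvg_totally_eq (cvg_totally_reindex (mincrK k) _ hl) => a.
  by rewrite /= dmonom_mincr /dcoef mulrCA mulrA.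
by move=> aa; rewrite dmonom_eq0// mulr0.
Unshelve. all: by end_near. Qed.

Lemma has_power_series_derive (f : 'rV[R]_n -> R) p c r k :
  0 < r -> has_power_series f p c r ->
  has_power_series ('D_(delta_mx 0 k) f) p (dcoef k c) r.
Proof. by move=> r0 fc h hr; case: (power_series_derive k r0 fc hr). Qed.

Lemma analytic_derivable f p k : analytic_at (f : 'rV[R]_n -> R) p ->
  derivable f p (delta_mx 0 k).
Proof.
move=> [c [r [r0 fc]]]; have h0 : polydisc r (0 : 'rV[R]_n).
  by move=> i; rewrite mxE normr0.
have [[]] := power_series_derive k r0 fc h0.
by rewrite addr0.
Qed.

Lemma analytic_derive f p k : analytic_at (f : 'rV[R]_n -> R) p ->
  analytic_at ('D_(delta_mx 0 k) f) p.
Proof.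
move=> [c [r [r0 fc]]]; exists (dcoef k c), r; split=> //.
exact: has_power_series_derive.
Qed.

(** Both mixed derivatives are limits of series at the centre with the same coefficients, by
    [dcoef_comm]. *)
Lemma analytic_derive_comm f p i j : analytic_at (f : 'rV[R]_n -> R) p ->
  'D_(delta_mx 0 i) ('D_(delta_mx 0 j) f) p =
  'D_(delta_mx 0 j) ('D_(delta_mx 0 i) f) p.
Proof.
move=> [c [r [r0 fc]]]; have h0 : polydisc r (0 : 'rV[R]_n).
  by move=> k; rewrite mxE normr0.
have hij (a b : 'I_n) := has_power_series_derive (k := a) r0
  (has_power_series_derive (k := b) r0 fc) h0.
rewrite -[p]addr0; apply: cvg_unique (hij i j) _ => //.
apply: cvg_totally_eq (hij j i) => a; by rewrite dcoef_comm.
Qed.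

End PowerSeries.

(** * Partial derivatives of complex-valued functions *)

Section ReIm.
Context (R : rcfType).
Implicit Types x y : R[i].

Lemma ReD x y : complex.Re (x + y) = complex.Re x + complex.Re y.
Proof. by case: x y => ? ? []. Qed.

Lemma ImD x y : complex.Im (x + y) = complex.Im x + complex.Im y.
Proof. by case: x y => ? ? []. Qed.

Lemma ReM x y : complex.Re (x * y) =
  complex.Re x * complex.Re y - complex.Im x * complex.Im y.
Proof. by case: x y => ? ? []. Qed.

Lemma ImM x y : complex.Im (x * y) =
  complex.Re x * complex.Im y + complex.Im x * complex.Re y.
Proof. by case: x y => ? ? []. Qed.

Lemma ReV x : complex.Re x^-1 =
  complex.Re x * (complex.Re x ^+ 2 + complex.Im x ^+ 2)^-1.
Proof. by case: x. Qed.

Lemma ImV x : complex.Im x^-1 =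
  - (complex.Im x * (complex.Re x ^+ 2 + complex.Im x ^+ 2)^-1).
Proof. by case: x. Qed.

Lemma Re_conjc x : complex.Re x^*%C = complex.Re x. Proof. by case: x. Qed.

Lemma Im_conjc x : complex.Im x^*%C = - complex.Im x. Proof. by case: x. Qed.

Lemma eq_ReIm x y : complex.Re x = complex.Re y ->
  complex.Im x = complex.Im y -> x = y.
Proof. by case: x y => ? ? [? ?] /= -> ->. Qed.

End ReIm.

Section ComplexPartial.
Context (R : realType) (n : nat).
Implicit Types (f g : 'rV[R]_n -> R[i]) (p : 'rV[R]_n) (k : 'I_n) (d e : R[i]).

(** Unlike an equation on [partial k f p], this also asserts that the derivatives of the real and
    imaginary parts exist. *)
Definition is_partial k f p d : Prop :=
  is_derive p (delta_mx 0 k) (fun q => complex.Re (f q)) (complex.Re d) /\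
  is_derive p (delta_mx 0 k) (fun q => complex.Im (f q)) (complex.Im d).

Lemma is_partial_val k f p d : is_partial k f p d -> partial k f p = d.
Proof. by case: d => a b [[_ /= ha] [_ /= hb]]; rewrite /partial ha hb. Qed.

Lemma is_partial_cst k c p : is_partial k (cst c) p 0.
Proof. by split; apply: is_derive_cst. Qed.

Lemma is_partialD k f g p d e : is_partial k f p d -> is_partial k g p e ->
  is_partial k (fun q => f q + g q) p (d + e).
Proof.
move=> [h1 h2] [h3 h4]; split.
- have -> : (fun q => complex.Re (f q + g q)) =
    (fun q => complex.Re (f q)) + (fun q => complex.Re (g q)).
    by apply/funext => q; exact: ReD.
  by rewrite ReD; apply: is_deriveD.
- have -> : (fun q => complex.Im (f q + g q)) =
    (fun q => complex.Im (f q)) + (fun q => complex.Im (g q)).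
    by apply/funext => q; exact: ImD.
  by rewrite ImD; apply: is_deriveD.
Qed.

Lemma is_partialM k f g p d e : is_partial k f p d -> is_partial k g p e ->
  is_partial k (fun q => f q * g q) p (f p * e + d * g p).
Proof.
move=> [h1 h2] [h3 h4]; split.
- have -> : (fun q => complex.Re (f q * g q)) =
    (fun q => complex.Re (f q)) * (fun q => complex.Re (g q)) -
    (fun q => complex.Im (f q)) * (fun q => complex.Im (g q)).
    by apply/funext => q; exact: ReM.
  apply: is_derive_eq; rewrite /GRing.scale /=.
  by rewrite ReD !ReM; ring.
- have -> : (fun q => complex.Im (f q * g q)) =
    (fun q => complex.Re (f q)) * (fun q => complex.Im (g q)) +
    (fun q => complex.Im (f q)) * (fun q => complex.Re (g q)).
    by apply/funext => q; exact: ImM.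
  apply: is_derive_eq; rewrite /GRing.scale /=.
  by rewrite ImD !ImM; ring.
Qed.

Lemma is_partial_conj k f p d : is_partial k f p d ->
  is_partial k (fun q => (f q)^*%C) p d^*%C.
Proof.
move=> [h1 h2]; split.
- have -> : (fun q => complex.Re (f q)^*%C) = (fun q => complex.Re (f q)).
    by apply/funext => q; exact: Re_conjc.
  by rewrite Re_conjc.
- have -> : (fun q => complex.Im (f q)^*%C) = - (fun q => complex.Im (f q)).
    by apply/funext => q; exact: Im_conjc.
  by rewrite Im_conjc; apply: is_deriveN.
Qed.

Lemma is_partialV k f p d : f p != 0 -> is_partial k f p d ->
  is_partial k (fun q => (f q)^-1) p (- d * (f p)^-1 ^+ 2).
Proof.
move=> fp0 [h1 h2].
(* The squared modulus of [f], the common denominator of the real and imaginary parts of its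
   inverse. *)
pose N q := complex.Re (f q) ^+ 2 + complex.Im (f q) ^+ 2.
have Np0 : N p != 0.
  apply: contra fp0; rewrite /N paddr_eq0 ?sqr_ge0// !sqrf_eq0.
  by case: (f p) => a b; rewrite eq_complex.
have hN : is_derive p (delta_mx 0 k) (fun q => (N q)^-1)
    (- (N p) ^- 2 * (2 * (complex.Re (f p) * complex.Re d +
                        complex.Im (f p) * complex.Im d))).
  have hN' : is_derive p (delta_mx 0 k) N (2 * (complex.Re (f p) * complex.Re d +
                        complex.Im (f p) * complex.Im d)).
    have -> : N = (fun q => complex.Re (f q)) ^+ 2 + (fun q => complex.Im (f q)) ^+ 2.
      by apply/funext => q.
    by apply: is_derive_eq; rewrite /GRing.scale /= !expr1; ring.
  apply: DeriveDef; first by apply: derivableV => //; case: hN'.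
  by rewrite deriveV//; case: hN' => // ? ->.
split.
- have -> : (fun q => complex.Re (f q)^-1) =
    (fun q => complex.Re (f q)) * (fun q => (N q)^-1).
    by apply/funext => q; exact: ReV.
  apply: is_derive_eq; rewrite /GRing.scale /=; move: Np0; rewrite /N.
  by case: (f p) d {h1 h2 hN fp0} => a b [u v] /= Np0; field.
- have -> : (fun q => complex.Im (f q)^-1) =
    - ((fun q => complex.Im (f q)) * (fun q => (N q)^-1)).
    by apply/funext => q; exact: ImV.
  apply: is_derive_eq; rewrite /GRing.scale /=; move: Np0; rewrite /N.
  by case: (f p) d {h1 h2 hN fp0} => a b [u v] /= Np0; field.
Qed.

Lemma is_partial_near k f g p d : (\near p, f p = g p) ->
  is_partial k f p d -> is_partial k g p d.
Proof.
move=> fg [h1 h2]; split.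
  by apply: near_eq_is_derive h1; apply: filterS fg => q ->.
by apply: near_eq_is_derive h2; apply: filterS fg => q ->.
Qed.

Lemma is_partial_open (U : set 'rV[R]_n) k f g p d : open U -> U p ->
  (forall q, U q -> f q = g q) -> is_partial k f p d -> is_partial k g p d.
Proof.
move=> Uo Up fg; apply: is_partial_near.
by apply: filterS (open_nbhs_nbhs (conj Uo Up)).
Qed.

Lemma partial_open (U : set 'rV[R]_n) k f g p : open U -> U p ->
  (forall q, U q -> f q = g q) -> partial k f p = partial k g p.
Proof.
move=> Uo Up fg; rewrite /partial; congr (_ +i* _); apply: near_eq_derive;
  by apply: filterS (open_nbhs_nbhs (conj Uo Up)) => q /fg ->.
Qed.

End ComplexPartial.

(** * Functions smooth on an open set, and the symmetry of their second partial derivatives *)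

Section Smooth.
Context (R : realType) (n : nat) (U : set 'rV[R]_n) (Uo : open U).
Implicit Types (f g : 'rV[R]_n -> R[i]) (p : 'rV[R]_n) (k : 'I_n).

(* Being inductively generated, this class has its stability under partial
   derivatives and the symmetry of second derivatives proved by induction from
   the case of power series, without Schwarz's theorem. *)
Inductive smooth : ('rV[R]_n -> R[i]) -> Prop :=
| smooth_analytic f of
    (forall p, U p -> analytic_at (fun q => complex.Re (f q)) p) &
    (forall p, U p -> analytic_at (fun q => complex.Im (f q)) p) : smooth f
| smooth_cst c : smooth (cst c)
| smoothD f g of smooth f & smooth g : smooth (fun q => f q + g q)
| smoothM f g of smooth f & smooth g : smooth (fun q => f q * g q)
| smoothV f of smooth f & (forall p, U p -> f p != 0) :
    smooth (fun q => (f q)^-1)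
| smooth_conj f of smooth f : smooth (fun q => (f q)^*%C)
| smooth_ext f g of smooth f & (forall p, U p -> f p = g p) : smooth g.

(** Existence of the derivative and smoothness of [partial k f] go through one induction: existence
    on [U] yields the differentiation rule on [U], and [smooth_ext] transfers smoothness from the
    expression in that rule, the two agreeing only there. *)
Lemma smooth_is_partial f : smooth f ->
  forall k, (forall p, U p -> is_partial k f p (partial k f p)) /\
    smooth (partial k f).
Proof.
move=> sf k; elim: sf => {f}.
- move=> f ref imf; split=> [p Up|].
    by split; apply/derivableP/analytic_derivable; [exact: ref|exact: imf].
  by apply: smooth_analytic => p Up; apply: analytic_derive; [exact: ref|exact: imf].
- move=> c; have h p := is_partial_cst k c p; split=> [p Up|].
    by rewrite (is_partial_val (h p)).
  apply: smooth_ext (smooth_cst 0) _ => p _.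
  by rewrite (is_partial_val (h p)).
- move=> f g sf [hf sdf] sg [hg sdg].
  have h p (Up : U p) := is_partialD (hf p Up) (hg p Up).
  split=> [p Up|]; first by rewrite (is_partial_val (h p Up)); exact: h.
  apply: smooth_ext (smoothD sdf sdg) _ => p Up.
  by rewrite (is_partial_val (h p Up)).
- move=> f g sf [hf sdf] sg [hg sdg].
  have h p (Up : U p) := is_partialM (hf p Up) (hg p Up).
  split=> [p Up|]; first by rewrite (is_partial_val (h p Up)); exact: h.
  apply: smooth_ext (smoothD (smoothM sf sdg) (smoothM sdf sg)) _ => p Up.
  by rewrite (is_partial_val (h p Up)).
- move=> f sf [hf sdf] f0.
  have h p (Up : U p) := is_partialV (f0 p Up) (hf p Up).
  split=> [p Up|]; first by rewrite (is_partial_val (h p Up)); exact: h.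
  have sV := smoothV sf f0.
  apply: smooth_ext (smoothM (smooth_cst (-1)) (smoothM sdf (smoothM sV sV))) _.
  by move=> p Up; rewrite (is_partial_val (h p Up)) mulN1r expr2 mulNr.
- move=> f sf [hf sdf].
  have h p (Up : U p) := is_partial_conj (hf p Up).
  split=> [p Up|]; first by rewrite (is_partial_val (h p Up)); exact: h.
  apply: smooth_ext (smooth_conj sdf) _ => p Up.
  by rewrite (is_partial_val (h p Up)).
- move=> f g sf [hf sdf] fg.
  have e p (Up : U p) := partial_open k Uo Up fg.
  split=> [p Up|].
    by rewrite -(e p Up); apply: is_partial_open Uo Up fg (hf p Up).
  exact: smooth_ext sdf e.
Qed.

Lemma smooth_partial k f : smooth f -> smooth (partial k f).
Proof. by case/(smooth_is_partial)/(_ k). Qed.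

Lemma smooth_partialP k f p : smooth f -> U p -> is_partial k f p (partial k f p).
Proof. by move=> /smooth_is_partial/(_ k)[+ _]; exact. Qed.

Lemma partial_cst k c p : partial k (cst c) p = 0 :> R[i].
Proof. exact: is_partial_val (is_partial_cst _ _ _). Qed.

Lemma partialD k f g p : smooth f -> smooth g -> U p ->
  partial k (fun q => f q + g q) p = partial k f p + partial k g p.
Proof.
by move=> sf sg Up; apply/is_partial_val/is_partialD; exact: smooth_partialP.
Qed.

Lemma partialM k f g p : smooth f -> smooth g -> U p ->
  partial k (fun q => f q * g q) p = f p * partial k g p + partial k f p * g p.
Proof.
by move=> sf sg Up; apply/is_partial_val/is_partialM; exact: smooth_partialP.
Qed.

Lemma partialV k f p : smooth f -> f p != 0 -> U p ->
  partial k (fun q => (f q)^-1) p = - partial k f p * (f p)^-1 ^+ 2.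
Proof.
by move=> sf fp Up; apply/is_partial_val/is_partialV => //; exact: smooth_partialP.
Qed.

Lemma partial_conj k f p : smooth f -> U p ->
  partial k (fun q => (f q)^*%C) p = (partial k f p)^*%C.
Proof.
by move=> sf Up; apply/is_partial_val/is_partial_conj; exact: smooth_partialP.
Qed.

(** In each case the inner derivative is replaced by its formula on all of [U], since the outer one
    sees a neighbourhood. The resulting second-order formula is symmetric in the two directions by
    the induction hypotheses. *)
Lemma partial_comm f : smooth f -> forall i j p, U p ->
  partial i (partial j f) p = partial j (partial i f) p.
Proof.
move=> sf i j; elim: sf => {f}.
- move=> f ref imf p Up; apply: eq_ReIm.
    exact: (analytic_derive_comm i j (ref p Up)).
  exact: (analytic_derive_comm i j (imf p Up)).
- move=> c p Up.
  have d0 k l : partial k (partial l (cst c)) p = 0 :> R[i].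
    rewrite (_ : partial l (cst c) = cst 0) ?partial_cst//.
    by apply/funext => q; rewrite partial_cst.
  by rewrite (d0 i j) (d0 j i).
- move=> f g sf hf sg hg p Up.
  have e k l : partial k (partial l (fun q => f q + g q)) p =
      partial k (partial l f) p + partial k (partial l g) p.
    rewrite (partial_open (g := fun q => partial l f q + partial l g q) _ Uo Up).
      by rewrite partialD//; exact: smooth_partial.
    by move=> q Uq; exact: partialD.
  by rewrite (e i j) (e j i) (hf p Up) hg.
- move=> f g sf hf sg hg p Up.
  have e k l : partial k (partial l (fun q => f q * g q)) p =
      (f p * partial k (partial l g) p + partial k f p * partial l g p) +
      (partial l f p * partial k g p + partial k (partial l f) p * g p).
    rewrite (partial_open (g := fun q => f q * partial l g q + partial l f q * g q)
      _ Uo Up).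
      have sdf := smooth_partial l sf; have sdg := smooth_partial l sg.
      by rewrite partialD ?partialM//; exact: smoothM.
    by move=> q Uq; exact: partialM.
  apply: etrans (e i j) (etrans _ (esym (e j i))).
  have -> := hf p Up; have -> := hg p Up.
  move: (f p) (g p) (partial j (partial i f) p) (partial j (partial i g) p).
  move: (partial i f p) (partial j f p) (partial i g p) (partial j g p).
  by move=> *; ring.
- move=> f sf hf f0 p Up.
  have sV := smoothV sf f0.
  have e k l : partial k (partial l (fun q => (f q)^-1)) p =
      - partial k (partial l f) p * (f p)^-1 ^+ 2 +
      2 * partial l f p * partial k f p * (f p)^-1 ^+ 3.
    rewrite (partial_open
      (g := fun q => -1 * (partial l f q * ((f q)^-1 * (f q)^-1))) _ Uo Up).
      have sdf := smooth_partial l sf.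
      have sVV := smoothM sV sV.
      rewrite (partialM _ (smooth_cst _) (smoothM sdf sVV) Up).
      rewrite (partialM _ sdf sVV Up) (partialM _ sV sV Up).
      rewrite (partialV _ sf (f0 _ Up) Up) partial_cst -[cst _ p]/(-1 : R[i]).
      move: (f p)^-1 (partial k (partial l f) p) (partial k f p) (partial l f p).
      by move=> a b c d; ring.
    by move=> q Uq; rewrite partialV ?f0//; ring.
  apply: etrans (e i j) (etrans _ (esym (e j i))).
  have -> := hf p Up.
  move: (f p)^-1 (partial j (partial i f) p) (partial i f p) (partial j f p).
  by move=> *; ring.
- move=> f sf hf p Up.
  have e k l : partial k (partial l (fun q => (f q)^*%C)) p =
      (partial k (partial l f) p)^*%C.
    rewrite (partial_open (g := fun q => (partial l f q)^*%C) _ Uo Up).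
      by rewrite partial_conj//; exact: smooth_partial.
    by move=> q Uq; exact: partial_conj.
  by rewrite (e i j) (e j i) (hf p Up).
- move=> f g sf hf fg p Up.
  have e k l : partial k (partial l g) p = partial k (partial l f) p.
    apply: (partial_open _ Uo Up) => q Uq; apply: (partial_open _ Uo Uq) => s Us.
    by rewrite fg.
  by rewrite (e i j) (e j i) (hf p Up).
Qed.

Lemma smooth_sum (I : Type) (r : seq I) (F : I -> 'rV[R]_n -> R[i]) :
  (forall i, smooth (F i)) -> smooth (fun q => \sum_(i <- r) F i q).
Proof.
move=> sF; elim: r => [|i r IH].
  by apply: smooth_ext (smooth_cst 0) _ => p _; rewrite big_nil.
by apply: smooth_ext (smoothD (sF i) IH) _ => p _; rewrite big_cons.
Qed.

Lemma smooth_prod (I : Type) (r : seq I) (F : I -> 'rV[R]_n -> R[i]) :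
  (forall i, smooth (F i)) -> smooth (fun q => \prod_(i <- r) F i q).
Proof.
move=> sF; elim: r => [|i r IH].
  by apply: smooth_ext (smooth_cst 1) _ => p _; rewrite big_nil.
by apply: smooth_ext (smoothM (sF i) IH) _ => p _; rewrite big_cons.
Qed.

Lemma smooth_det m (A : 'rV[R]_n -> 'M[R[i]]_m) :
  (forall i j, smooth (fun q => A q i j)) -> smooth (fun q => \det (A q)).
Proof.
move=> sA; apply: smooth_sum => s; apply: smoothM; first exact: smooth_cst.
by apply: smooth_prod.
Qed.

Lemma smooth_invmx m (A : 'rV[R]_n -> 'M[R[i]]_m) :
  (forall p, U p -> A p \in unitmx) ->
  (forall i j, smooth (fun q => A q i j)) ->
  forall i j, smooth (fun q => invmx (A q) i j).
Proof.
move=> uA sA i j.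
have sV : smooth (fun q => (\det (A q))^-1).
  apply: smoothV; first exact: smooth_det.
  by move=> p Up; have := uA p Up; rewrite unitmxE unitfE.
have scof : smooth (fun q => cofactor (A q) j i).
  apply: smoothM; first exact: smooth_cst.
  apply: smooth_det => k l.
  by apply: smooth_ext (sA (lift j k) (lift i l)) _ => p _; rewrite !mxE.
apply: smooth_ext (smoothM sV scof) _ => p Up.
by rewrite /invmx uA// !mxE.
Qed.

End Smooth.

(** * Vector fields and the Jacobi identity *)

Section VectorFields.
Context (R : realType) (n : nat) (U : set 'rV[R]_n) (Uo : open U).
Implicit Types (f g : 'rV[R]_n -> R[i]) (p : 'rV[R]_n) (k : 'I_n)
  (X Y Z : vfield R n) (v : 'rV[R[i]]_n).

Definition smoothv X := forall k, smooth U (fun q => X q 0 k).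

Lemma vderive_open v f g p : U p -> (forall q, U q -> f q = g q) ->
  vderive v f p = vderive v g p.
Proof. by move=> Up fg; apply: eq_bigr => k _; rewrite (partial_open k Uo Up fg). Qed.

Lemma vderiveD v f g p : smooth U f -> smooth U g -> U p ->
  vderive v (fun q => f q + g q) p = vderive v f p + vderive v g p.
Proof.
move=> sf sg Up; rewrite /vderive -big_split; apply: eq_bigr => k _ /=.
by rewrite (partialD Uo)// mulrDr.
Qed.

Lemma vderiveM v f g p : smooth U f -> smooth U g -> U p ->
  vderive v (fun q => f q * g q) p = f p * vderive v g p + vderive v f p * g p.
Proof.
move=> sf sg Up; rewrite /vderive mulr_sumr mulr_suml -big_split.
by apply: eq_bigr => k _ /=; rewrite (partialM Uo)//; ring.
Qed.

Lemma vderive_cst v c p : vderive v (cst c) p = 0.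
Proof. by rewrite /vderive big1// => k _; rewrite partial_cst mulr0. Qed.

Lemma vderiveZ v c f p : smooth U f -> U p ->
  vderive v (fun q => c * f q) p = c * vderive v f p.
Proof.
move=> sf Up; rewrite (vderiveM _ (smooth_cst _ c))//.
by rewrite vderive_cst mul0r addr0.
Qed.

Lemma vderiveB v f g p : smooth U f -> smooth U g -> U p ->
  vderive v (fun q => f q - g q) p = vderive v f p - vderive v g p.
Proof.
move=> sf sg Up.
rewrite (vderive_open (g := fun q => f q + (-1) * g q) _ Up); last first.
  by move=> q _; rewrite mulN1r.
rewrite vderiveD ?vderiveZ ?mulN1r//.
by apply: smoothM sg; exact: smooth_cst.
Qed.

Lemma vderive_sum v (I : Type) (r : seq I) (F : I -> 'rV[R]_n -> R[i]) p :
  (forall i, smooth U (F i)) -> U p ->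
  vderive v (fun q => \sum_(i <- r) F i q) p = \sum_(i <- r) vderive v (F i) p.
Proof.
move=> sF Up; elim: r => [|i r IH].
  rewrite big_nil; apply: etrans (vderive_cst v 0 p).
  by apply: vderive_open Up _ => q _; rewrite big_nil.
rewrite big_cons -IH -vderiveD//; last exact: smooth_sum.
by apply: vderive_open Up _ => q _; rewrite big_cons.
Qed.

Lemma vderive_conj v f p : smooth U f -> U p ->
  vderive (map_mx conjc v) (fun q => (f q)^*%C) p = (vderive v f p)^*%C.
Proof.
move=> sf Up; rewrite /vderive rmorph_sum /=; apply: eq_bigr => k _.
by rewrite (partial_conj Uo)// !mxE rmorphM.
Qed.

Lemma smooth_vderive X f : smoothv X -> smooth U f ->
  smooth U (fun q => vderive (X q) f q).
Proof.
move=> sX sf; apply: smooth_sum => k; apply: smoothM; first exact: sX.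
exact: smooth_partial.
Qed.

Lemma smooth_sub f g : smooth U f -> smooth U g -> smooth U (fun q => f q - g q).
Proof.
move=> sf sg; apply: smooth_ext (smoothD sf (smoothM (smooth_cst _ (-1)) sg)) _.
by move=> p _; rewrite mulN1r.
Qed.

Lemma smoothv_bracket X Y : smoothv X -> smoothv Y -> smoothv (bracket X Y).
Proof.
move=> sX sY k.
apply: smooth_ext (smooth_sub (smooth_vderive sX (sY k)) (smooth_vderive sY (sX k))) _.
by move=> p _; rewrite mxE.
Qed.

Lemma smoothv_conj X : smoothv X -> smoothv (conjf X).
Proof.
by move=> sX k; apply: smooth_ext (smooth_conj (sX k)) _ => p _; rewrite mxE.
Qed.

Lemma smoothvZ c X : smoothv X -> smoothv (fun q => c *: X q).
Proof.
move=> sX k; apply: smooth_ext (smoothM (smooth_cst _ c) (sX k)) _ => p _.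
by rewrite mxE.
Qed.

Lemma bracketE X Y p k : bracket X Y p 0 k =
  vderive (X p) (fun q => Y q 0 k) p - vderive (Y p) (fun q => X q 0 k) p.
Proof. by rewrite mxE. Qed.

Lemma bracket_open X X' Y Y' p : U p -> (forall q, U q -> X q = X' q) ->
  (forall q, U q -> Y q = Y' q) -> bracket X Y p = bracket X' Y' p.
Proof.
move=> Up XX YY; apply/rowP => k; rewrite !bracketE (XX p Up) (YY p Up).
congr (_ - _); apply: vderive_open => // q Uq; by rewrite ?XX ?YY.
Qed.

Lemma bracketC X Y p : bracket X Y p = - bracket Y X p.
Proof. by apply/rowP => k; rewrite [in RHS]mxE !bracketE opprB. Qed.

Lemma bracket_self X p : bracket X X p = 0.
Proof. by apply/rowP => k; rewrite !mxE subrr. Qed.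

Lemma bracketZr c X Y p : smoothv Y -> U p ->
  bracket X (fun q => c *: Y q) p = c *: bracket X Y p.
Proof.
move=> sY Up; apply/rowP => k; rewrite [in RHS]mxE !bracketE mulrBr; congr (_ - _).
  rewrite -vderiveZ//; apply: vderive_open => // q _; by rewrite mxE.
by rewrite /vderive mulr_sumr; apply: eq_bigr => j _; rewrite !mxE mulrA.
Qed.

Lemma conjf_bracket X Y p : smoothv X -> smoothv Y -> U p ->
  conjf (bracket X Y) p = bracket (conjf X) (conjf Y) p.
Proof.
move=> sX sY Up; apply/rowP => k; rewrite [in LHS]mxE !bracketE rmorphB /=.
rewrite -(vderive_conj _ (sY k) Up) -(vderive_conj _ (sX k) Up).
by congr (_ - _); apply: vderive_open => // q _; rewrite mxE.
Qed.

(** Each iterated derivative splits into a Hessian term and a first-order term. The Hessian terms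
    agree by [partial_comm] and cancel; the first-order ones form the bracket. *)
Lemma vderive_bracket X Y f p : smoothv X -> smoothv Y -> smooth U f -> U p ->
  vderive (bracket X Y p) f p =
  vderive (X p) (fun q => vderive (Y q) f q) p -
  vderive (Y p) (fun q => vderive (X q) f q) p.
Proof.
have step X' Y' : smoothv X' -> smoothv Y' -> smooth U f -> U p ->
    vderive (X' p) (fun q => vderive (Y' q) f q) p =
    \sum_k \sum_j Y' p 0 k * X' p 0 j * partial j (partial k f) p +
    \sum_k vderive (X' p) (fun q => Y' q 0 k) p * partial k f p.
  move=> sX sY sf Up; rewrite vderive_sum//; last first.
    by move=> k; apply: smoothM; [exact: sY|exact: smooth_partial].
  rewrite -big_split; apply: eq_bigr => k _ /=.
  rewrite vderiveM//; last exact: smooth_partial.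
  by congr (_ + _); rewrite /vderive mulr_sumr; apply: eq_bigr => j _; rewrite mulrA.
move=> sX sY sf Up; rewrite !step// [X in _ = _ - (X + _)]exchange_big /=.
rewrite [X in _ = _ - (X + _)](_ : _ =
  \sum_k \sum_j Y p 0 k * X p 0 j * partial j (partial k f) p); last first.
  apply: eq_bigr => k _; apply: eq_bigr => j _.
  by rewrite (partial_comm Uo)// [X p _ _ * _]mulrC.
rewrite opprD addrACA subrr add0r -sumrB; apply: eq_bigr => k _.
by rewrite bracketE mulrBl.
Qed.

(** Componentwise, [vderive_bracket] expands each double bracket into four iterated derivatives of
    coefficients; the twelve terms cancel in pairs. *)
Lemma jacobi X Y Z p : smoothv X -> smoothv Y -> smoothv Z -> U p ->
  bracket X (bracket Y Z) p + bracket Y (bracket Z X) p +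
  bracket Z (bracket X Y) p = 0.
Proof.
move=> sX sY sZ Up.
have step X' Y' Z' k : smoothv X' -> smoothv Y' -> smoothv Z' ->
    bracket X' (bracket Y' Z') p 0 k =
    vderive (X' p) (fun q => vderive (Y' q) (fun s => Z' s 0 k) q) p -
    vderive (X' p) (fun q => vderive (Z' q) (fun s => Y' s 0 k) q) p -
    (vderive (Y' p) (fun q => vderive (Z' q) (fun s => X' s 0 k) q) p -
     vderive (Z' p) (fun q => vderive (Y' q) (fun s => X' s 0 k) q) p).
  move=> sX' sY' sZ'; rewrite bracketE vderive_bracket//; congr (_ - _).
  rewrite -vderiveB//; try exact: smooth_vderive.
  by apply: vderive_open => // q _; rewrite bracketE.
apply/rowP => k; rewrite mxE [X in X + _]mxE [RHS]mxE.
rewrite (step X Y Z k sX sY sZ) (step Y Z X k sY sZ sX) (step Z X Y k sZ sX sY).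
pose D X' Y' Z' :=
  vderive (X' p) (fun q => vderive (Y' q) (fun s => Z' s 0 k) q) p.
rewrite -!/(D _ _ _).
move: (D X Y Z) (D X Z Y) (D Y Z X) (D Y X Z) (D Z X Y) (D Z Y X).
by move=> *; ring.
Qed.

End VectorFields.

(** * The generator of T^{0,1}M *)

Section Coordinates.
Context (R : realType).

Lemma analytic_cst0 n (p : 'rV[R]_n) : analytic_at (cst 0) p.
Proof.
exists (fun=> 0), 1; split=> // h _.
rewrite (_ : partial_sum _ = cst 0); first exact: cvg_cst.
by apply/funext => A; rewrite partial_sumE big1// => i _; rewrite mul0r.
Qed.

Lemma is_derive_coord n (p v : 'rV[R]_n) (i : 'I_n) :
  is_derive p v (fun q : 'rV[R]_n => q 0 i) (v 0 i).
Proof.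
have h : (fun t : R =>
    t^-1 *: (((fun q : 'rV[R]_n => q 0 i) \o shift p) (t *: v) - p 0 i)) @ 0^' --> (v 0 i : R).
  apply/cvgrPdist_le => e e0; near=> t.
  have t0 : t != 0 by near: t; exact: nbhs_dnbhs_neq.
  rewrite /= !mxE addrK /GRing.scale /= mulKf// subrr normr0; exact: ltW.
by apply: DeriveDef; [apply/cvg_ex; exists (v 0 i)|exact/cvg_lim].
Unshelve. all: by end_near. Qed.

Lemma partial_coord n k (i : 'I_n) (p : 'rV[R]_n) :
  partial k (fun q => (q 0 i)%:C) p = (i == k)%:R.
Proof.
apply: is_partial_val; split => /=.
  by apply: is_derive_eq; [exact: is_derive_coord|rewrite mxE eqxx /=; case: eqP].
rewrite (_ : complex.Im _ = 0); first exact: is_derive_cst.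
by case: eqP.
Qed.

Lemma vderive_coord n (X : 'rV[R[i]]_n) (i : 'I_n) (p : 'rV[R]_n) :
  vderive X (fun q => (q 0 i)%:C) p = X 0 i.
Proof.
rewrite /vderive (bigD1 i)//= partial_coord eqxx mulr1 big1 ?addr0// => k ki.
by rewrite partial_coord eq_sym (negbTE ki) mulr0.
Qed.

Lemma ord5_cases (k : 'I_5) : [\/ k = xix, k = yix | exists j, k = uix j].
Proof.
case: (@splitP 2 3 k) => j jk; last by constructor 3; exists j; apply: val_inj.
by case: j jk => [[|[|//]]] ? /= jk;
  [constructor 1|constructor 2]; apply: val_inj.
Qed.

Lemma sum_ord5 (V : zmodType) (F : 'I_5 -> V) :
  \sum_k F k = F xix + F yix + \sum_j F (uix j).
Proof.
rewrite (@big_split_ord _ _ _ 2 3) big_ord_recl big_ord1.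
by congr (_ + F _ + _); apply: val_inj.
Qed.

End Coordinates.

Section Generator.
Context (R : realType) (U : set 'rV[R]_5) (Uo : open U)
  (phi : 'I_3 -> 'rV[R]_5 -> R).
Local Notation F j := (fun q => (phi j q)%:C).


(** These equations say $X(z)=0$ and $X(w_j)=0$ on $M$: vectors of type (0,1) annihilate the
    holomorphic coordinates. The condition on [Jmap] amounts to $b=ia$ for the pair $(a,b)$, its
    other half being this equation multiplied by $i$. *)
Lemma T01P p (X : 'rV[R[i]]_5) : T01 phi p X <->
  X 0 yix = 'i%C * X 0 xix /\
  forall j, vderive X (F j) p = 'i%C * X 0 (uix j).
Proof.
have i2 : 'i%C * 'i%C = -1 :> R[i] by rewrite -expr2 sqr_i.
have gz q : graph phi q 0 (lshift 3 (0 : 'I_1)) = q 0 xix +i* q 0 yix.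
  by apply: etrans (row_mxEl _ _ _ _) _; rewrite mxE.
have gw q j : graph phi q 0 (rshift 1 j) = q 0 (uix j) +i* phi j q.
  by apply: etrans (row_mxEr _ _ _ _) _; rewrite mxE.
have pushRe m : (push phi p X).1 0 m =
    vderive X (fun q => (complex.Re (graph phi q 0 m))%:C) p.
  by rewrite /push /fst mxE.
have pushIm m : (push phi p X).2 0 m =
    vderive X (fun q => (complex.Im (graph phi q 0 m))%:C) p.
  by rewrite /push /snd mxE.
have a0 : (push phi p X).1 0 (lshift 3 (0 : 'I_1)) = X 0 xix.
  rewrite pushRe; apply: etrans (vderive_coord X xix p).
  by congr (vderive X _ p); apply/funext => q; rewrite gz.
have b0 : (push phi p X).2 0 (lshift 3 (0 : 'I_1)) = X 0 yix.
  rewrite pushIm; apply: etrans (vderive_coord X yix p).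
  by congr (vderive X _ p); apply/funext => q; rewrite gz.
have aj j : (push phi p X).1 0 (rshift 1 j) = X 0 (uix j).
  rewrite pushRe; apply: etrans (vderive_coord X (uix j) p).
  by congr (vderive X _ p); apply/funext => q; rewrite gw.
have bj j : (push phi p X).2 0 (rshift 1 j) = vderive X (F j) p.
  by rewrite pushIm; congr (vderive X _ p); apply/funext => q; rewrite gw.
change (T01 phi p X) with (Jmap (push phi p X) = - 'i%C *: push phi p X).
move: a0 b0 aj bj; case: (push phi p X) => a b /= a0 b0 aj bj.
rewrite /Jmap /=.
split=> [[ba ab]|[h0 hj]].
  have hb m : b 0 m = 'i%C * a 0 m.
    by move/rowP/(_ m): ba; rewrite !mxE mulNr => /oppr_inj.
  split; first by rewrite -a0 -b0 hb.
  by move=> j; rewrite -aj -bj hb.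
have hb m : b 0 m = 'i%C * a 0 m.
  case: (@splitP 1 3 m) => j jm.
    have -> : m = lshift 3 (0 : 'I_1) by apply: val_inj; rewrite /= jm ord1.
    by rewrite a0 b0.
  have -> : m = rshift 1 j by apply: val_inj.
  by rewrite aj bj.
congr pair; apply/rowP => m; rewrite !mxE hb ?mulNr//.
by rewrite mulrA i2 mulN1r opprK.
Qed.

Hypothesis phi_an : forall j p, U p -> analytic_at (phi j) p.

Lemma smooth_phi j : smooth U (F j).
Proof.
by apply: smooth_analytic => p Up; [exact: phi_an|exact: analytic_cst0].
Qed.

Context (Lbar : vfield R 5) (gen : T01_generator phi U Lbar).

Let N p : 'M[R[i]]_3 :=
  \matrix_(j, k) ((j == k)%:R * 'i%C - partial (uix k) (F j) p).

Let rhs p : 'cV[R[i]]_3 :=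
  \col_j (2^-1 * partial xix (F j) p + 'i%C / 2 * partial yix (F j) p).

Let row_N p (v : 'cV[R[i]]_3) j :
  (N p *m v) j 0 = 'i%C * v j 0 - \sum_k v k 0 * partial (uix k) (F j) p.
Proof.
rewrite mxE (eq_bigr (fun k => (j == k)%:R * 'i%C * v k 0 -
  v k 0 * partial (uix k) (F j) p)); last first.
  by move=> k _; rewrite mxE mulrBl [_ * v k 0 in X in _ - X]mulrC.
rewrite big_split sumrN /=; congr (_ - _).
rewrite (bigD1 j)//= eqxx mul1r big1 ?addr0// => k kj.
by rewrite eq_sym (negbTE kj) !mul0r.
Qed.

Let unit_N p : U p -> N p \in unitmx.
Proof.
move=> Up; rewrite -unitmx_tr -row_free_unit; apply: inj_row_free => v vN.
have Nv : N p *m v^T = 0 by rewrite -[N p]trmxK -trmx_mul vN trmx0.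
have [hx _ hT] := gen Up.
(* A kernel vector padded by zero x- and y-components solves the equations of [T01P], so it is a
   multiple of [Lbar p]. Since [Lbar p] has x-component 1/2, the factor is zero. *)
pose Y : 'rV[R[i]]_5 := row_mx (0 : 'rV_2) v.
have Y0 (l : 'I_2) : Y 0 (lshift 3 l) = 0.
  by apply: etrans (row_mxEl _ _ _ _) _; rewrite mxE.
have Yj j : Y 0 (uix j) = v 0 j by apply: row_mxEr.
have : T01 phi p Y.
  apply/T01P; split; first by rewrite !Y0 mulr0.
  move=> j; rewrite /vderive sum_ord5 !Y0 !mul0r !add0r Yj.
  have := row_N p v^T j; rewrite Nv !mxE => /esym/eqP; rewrite subr_eq0 => /eqP ->.
  by apply: eq_bigr => k _; rewrite Yj mxE.
rewrite hT => -[a Ya].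
have a0 : a = 0.
  have := Y0 0; rewrite Ya mxE hx => /eqP.
  by rewrite mulf_eq0 invr_eq0 pnatr_eq0 orbF => /eqP.
by apply/rowP => j; rewrite -Yj Ya a0 scale0r !mxE.
Qed.

Lemma smoothv_generator : smoothv U Lbar.
Proof.
have sN i j : smooth U (fun q => N q i j).
  apply: smooth_ext (smooth_sub (smooth_cst U ((i == j)%:R * 'i%C))
    (smooth_partial Uo (uix j) (smooth_phi i))) _ => p _.
  by rewrite mxE.
have srhs j : smooth U (fun q => rhs q j 0).
  apply: smooth_ext (smoothD
    (smoothM (smooth_cst U 2^-1) (smooth_partial Uo xix (smooth_phi j)))
    (smoothM (smooth_cst U ('i%C / 2)) (smooth_partial Uo yix (smooth_phi j)))) _.
  by move=> p _; rewrite mxE.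
move=> k; case: (ord5_cases k) => [->|->|[j ->]].
- by apply: smooth_ext (smooth_cst U 2^-1) _ => p /gen[->].
- by apply: smooth_ext (smooth_cst U ('i%C / 2)) _ => p /gen[_ ->].
- have s : smooth U (fun q => (invmx (N q) *m rhs q) j 0).
    apply: smooth_ext (smooth_sum (index_enum _) (fun k =>
      smoothM (smooth_invmx unit_N sN j k) (srhs k))) _ => p _.
    by rewrite mxE.
  apply: smooth_ext s _ => p Up; have [hx hy hT] := gen Up.
  pose a : 'cV[R[i]]_3 := \col_j Lbar p 0 (uix j).
  suff : N p *m a = rhs p.
    by move=> <-; rewrite mulKmx ?unit_N// mxE.
  apply/colP => l; rewrite row_N !mxE.
  have : T01 phi p (Lbar p) by rewrite hT; exists 1; rewrite scale1r.
  move=> /T01P[_ /(_ l)]; rewrite /vderive sum_ord5 hx hy => <-.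
  rewrite [X in _ - X](eq_bigr (fun k => Lbar p 0 (uix k) * partial (uix k) (F l) p)).
    by rewrite addrK.
  by move=> i _; rewrite mxE.
Qed.

End Generator.

(** * The frame *)

Lemma sum_tuple5 (K : nzRingType) (V : lmodType K) (k : 'I_5 -> K)
    (v0 v1 v2 v3 v4 : V) :
  \sum_i k i *: [tuple v0; v1; v2; v3; v4]`_i =
  k (inord 0) *: v0 + k (inord 1) *: v1 + k (inord 2) *: v2 +
  k (inord 3) *: v3 + k (inord 4) *: v4.
Proof.
rewrite !big_ord_recr big_ord0 /= add0r.
by congr (k _ *: _ + k _ *: _ + k _ *: _ + k _ *: _ + k _ *: _);
  apply: val_inj; rewrite /= inordK.
Qed.

Section FrameRelations.
Context (R : realType) (U : set 'rV[R]_5) (Uo : open U) (Lbar : vfield R 5).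
Context (sLbar : smoothv U Lbar).

Let L := Lfield Lbar.
Let T := Tfield Lbar.
Let S := Sfield Lbar.
Let Sbar := Sbarfield Lbar.

Let sL : smoothv U L. Proof. exact: smoothv_conj. Qed.
Let sT : smoothv U T. Proof. by apply/smoothvZ/smoothv_bracket. Qed.

Lemma smoothv_Sfield : smoothv U S. Proof. exact: smoothv_bracket. Qed.
Lemma smoothv_Sbarfield : smoothv U Sbar. Proof. exact: smoothv_bracket. Qed.

Lemma conjf_Lfield : conjf L = Lbar.
Proof.
by apply/funext => p; apply/rowP => k; rewrite !mxE conjcK.
Qed.

(** Conjugation changes the sign of $i$ and exchanges the arguments of the bracket; the two signs
    cancel. *)
Lemma conjf_Tfield p : U p -> conjf T p = T p.
Proof.
move=> Up; have -> : conjf T p = - 'i%C *: conjf (bracket L Lbar) p.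
  apply/rowP => k; rewrite [LHS]mxE [T p 0 k]mxE [RHS]mxE [conjf _ p 0 k]mxE rmorphM.
  by congr (_ * _); apply: eq_ReIm; rewrite /= ?oppr0.
rewrite (conjf_bracket Uo sL sLbar Up) conjf_Lfield bracketC scaleNr scalerN opprK.
by [].
Qed.

Lemma conjf_Sfield p : U p -> conjf S p = Sbar p.
Proof.
move=> Up; rewrite (conjf_bracket Uo sL sT Up) conjf_Lfield.
exact: (bracket_open Uo Up (fun q _ => erefl) conjf_Tfield).
Qed.

Lemma conjf_Sbarfield p : U p -> conjf Sbar p = S p.
Proof.
move=> Up; rewrite (conjf_bracket Uo sLbar sT Up).
exact: (bracket_open Uo Up (fun q _ => erefl) conjf_Tfield).
Qed.

Lemma conjf_bracket_LS p : U p -> conjf (bracket L S) p = bracket Lbar Sbar p.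
Proof.
move=> Up; rewrite (conjf_bracket Uo sL smoothv_Sfield Up) conjf_Lfield.
exact: (bracket_open Uo Up (fun q _ => erefl) conjf_Sfield).
Qed.

Lemma conjf_bracket_LbarS p : U p -> conjf (bracket Lbar S) p = bracket L Sbar p.
Proof.
move=> Up; rewrite (conjf_bracket Uo sLbar smoothv_Sfield Up).
exact: (bracket_open Uo Up (fun q _ => erefl) conjf_Sfield).
Qed.

(* In the Jacobi identity for [Lbar, L, T] the third term is a multiple of
   [[T, T]] because [[L, Lbar] = - i T]. *)
Lemma bracket_LbarS p : U p -> bracket Lbar S p = bracket L Sbar p.
Proof.
move=> Up; have := jacobi Uo sLbar sL sT Up.
have LLbar q : bracket Lbar L q = 'i%C *: T q.
  by rewrite /T /Tfield scalerA -expr2 sqr_i scaleN1r bracketC.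
have -> : bracket T (bracket Lbar L) p = 0.
  rewrite (bracket_open Uo Up (X' := T) (Y' := fun q => 'i%C *: T q))//.
  by rewrite (bracketZr Uo _ _ sT Up) bracket_self scaler0.
have -> : bracket L (bracket T Lbar) p = - bracket L Sbar p.
  rewrite (bracket_open Uo Up (X' := L) (Y' := fun q => -1 *: Sbar q))//.
    by rewrite (bracketZr Uo _ _ smoothv_Sbarfield Up) scaleN1r.
  by move=> q _; rewrite scaleN1r bracketC.
by rewrite addr0 => /eqP; rewrite subr_eq0 => /eqP.
Qed.

(** * Verticality of the brackets and expansion in the frame *)

Definition xy_constant (X : vfield R 5) : Prop :=
  exists c d, forall q, U q -> X q 0 xix = c /\ X q 0 yix = d.

(** These are the fields tangent to the fibres of the projection of $M$ to the $z$-axis. *)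
Definition vertical (X : vfield R 5) : Prop :=
  forall q, U q -> X q 0 xix = 0 /\ X q 0 yix = 0.

Lemma vertical_xy_constant X : vertical X -> xy_constant X.
Proof. by exists 0, 0. Qed.

(** The x- and y-components of the bracket are differences of derivatives of constants. *)
Lemma vertical_bracket X Y : xy_constant X -> xy_constant Y ->
  vertical (bracket X Y).
Proof.
move=> [a [b Xab]] [c [d Ycd]] p Up; rewrite !bracketE.
rewrite (vderive_open Uo (g := cst c) _ Up (fun q Uq => (Ycd q Uq).1)).
rewrite (vderive_open Uo (g := cst a) _ Up (fun q Uq => (Xab q Uq).1)).
rewrite (vderive_open Uo (g := cst d) _ Up (fun q Uq => (Ycd q Uq).2)).
rewrite (vderive_open Uo (g := cst b) _ Up (fun q Uq => (Xab q Uq).2)).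
by rewrite !vderive_cst subr0.
Qed.

Context (maxmin : maximally_minimal Lbar U).
Context (Lxy : forall p, U p -> Lbar p 0 xix = 2^-1 /\ Lbar p 0 yix = 'i%C / 2).

Lemma Lfield_xy p : U p -> L p 0 xix = 2^-1 /\ L p 0 yix = - ('i%C / 2).
Proof.
move=> /Lxy[Lx Ly]; have L_E k : L p 0 k = (Lbar p 0 k)^*%C by rewrite mxE.
rewrite !L_E Lx Ly; split; first by rewrite fmorphV rmorph_nat.
rewrite fmorph_div rmorph_nat -mulNr.
by congr (_ / _); apply: eq_ReIm; rewrite /= ?oppr0.
Qed.

Let Lbar_xyc : xy_constant Lbar. Proof. by exists 2^-1, ('i%C / 2). Qed.

Let L_xyc : xy_constant L.
Proof. by exists 2^-1, (- ('i%C / 2)); exact: Lfield_xy. Qed.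

Lemma vertical_Tfield : vertical T.
Proof.
move=> p Up; have T_E k : T p 0 k = 'i%C * bracket L Lbar p 0 k by rewrite mxE.
by have [h1 h2] := vertical_bracket L_xyc Lbar_xyc Up; rewrite !T_E h1 h2 mulr0.
Qed.

Lemma vertical_Sfield : vertical S.
Proof. exact: vertical_bracket L_xyc (vertical_xy_constant vertical_Tfield). Qed.

Lemma vertical_Sbarfield : vertical Sbar.
Proof.
exact: vertical_bracket Lbar_xyc (vertical_xy_constant vertical_Tfield).
Qed.

Let frame p : 5.-tuple 'rV[R[i]]_5 := [tuple Sbar p; S p; T p; Lbar p; L p].

Let basis_frame p : U p -> basis_of fullv (frame p).
Proof. exact: maxmin. Qed.

Let sum_frame p (k : 'I_5 -> R[i]) : \sum_i k i *: (frame p)`_i =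
  k (inord 0) *: Sbar p + k (inord 1) *: S p + k (inord 2) *: T p +
  k (inord 3) *: Lbar p + k (inord 4) *: L p.
Proof. exact: sum_tuple5. Qed.

(* The x- and y-components of a combination of the frame determine the
   coefficients of Lbar and L. *)
Lemma vertical_combination (V : vfield R 5) : vertical V -> exists a b c,
  forall p, U p -> V p = a p *: T p + b p *: S p + c p *: Sbar p.
Proof.
move=> V0; pose k p i := coord (frame p) i (V p).
(* The frame is listed as [Sbar], [S], [T], [Lbar], [L], so the coefficients of [T], [S], [Sbar]
   have indices 2, 1, 0. *)
exists (k ^~ (inord 2)), (k ^~ (inord 1)), (k ^~ (inord 0)) => p Up.
have := coord_basis (basis_frame Up) (memvf (V p)).
rewrite (sum_frame p (k p)).
move: (k p) => {}k e.
have comp i : V p 0 i = k (inord 0) * Sbar p 0 i + k (inord 1) * S p 0 i +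
    k (inord 2) * T p 0 i + k (inord 3) * Lbar p 0 i + k (inord 4) * L p 0 i.
  rewrite e; move: (Sbar p) (S p) (T p) (Lbar p) (L p) => v0 v1 v2 v3 v4.
  by rewrite !mxE.
have [Vx Vy] := V0 p Up; have [Lx Ly] := Lfield_xy Up.
have [Lbx Lby] := Lxy Up; have [Tx Ty] := vertical_Tfield Up.
have [Sx Sy] := vertical_Sfield Up; have [Sbx Sby] := vertical_Sbarfield Up.
have ex := comp xix; have ey := comp yix.
rewrite Vx Lx Lbx Tx Sx Sbx !mulr0 !add0r in ex.
rewrite Vy Ly Lby Ty Sy Sby !mulr0 !add0r in ey.
have two : 2 != 0 :> R[i] by rewrite pnatr_eq0.
have i0 : 'i%C != 0 :> R[i] by rewrite eq_complex /= oner_eq0 andbF.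
(* [Lbar] and [L] have equal x-components 1/2 and opposite y-components, so the coefficients with
   indices 3 and 4 have zero sum and zero difference. *)
have k34 : k (inord 3) = - k (inord 4).
  move: ex; rewrite -mulrDl => /esym/eqP.
  by rewrite mulf_eq0 invr_eq0 (negbTE two) orbF addr_eq0 => /eqP.
have k4 : k (inord 4) = 0.
  move: ey; rewrite k34 mulrN mulNr -opprD => /esym/eqP.
  rewrite oppr_eq0 -mulr2n mulrn_eq0 /= mulf_eq0 mulf_eq0 invr_eq0.
  by rewrite (negbTE two) (negbTE i0) !orbF => /eqP.
rewrite e k34 k4 oppr0 !scale0r !addr0.
by rewrite addrC [X in _ + X]addrC addrA.
Qed.

Lemma vertical_combination_unique p a b c a' b' c' : U p ->
  a *: T p + b *: S p + c *: Sbar p = a' *: T p + b' *: S p + c' *: Sbar p ->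
  [/\ a = a', b = b' & c = c'].
Proof.
move=> Up e; have := basis_free (basis_frame Up).
(* The default 0 of [nth] supplies the coefficients of [Lbar] and [L]. *)
move=> /freeP/(_ (fun i : 'I_5 => nth 0 [:: c - c'; b - b'; a - a'] i)).
rewrite sum_frame !inordK//= !scale0r !addr0 => h.
have z : (c - c') *: Sbar p + (b - b') *: S p + (a - a') *: T p = 0.
  move/eqP: e; rewrite -subr_eq0 => /eqP <-.
  rewrite !scalerBl; move: (Sbar p) (S p) (T p) => v0 v1 v2.
  apply/rowP => j; rewrite !mxE; ring.
by split; apply/eqP; rewrite -subr_eq0; apply/eqP;
  [have := h z (inord 2)|have := h z (inord 1)|have := h z (inord 0)];
  rewrite inordK.
Qed.

End FrameRelations.

Theorem lemma1p6 (R : realType) (U : set 'rV[R]_5)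
    (phi : 'I_3 -> 'rV[R]_5 -> R) (Lbar : vfield R 5)
    (U_open : open U) (U0 : U 0)
    (phi_analytic : forall j p, U p -> analytic_at (phi j) p)
    (phi0 : forall j, phi j 0 = 0)
    (dphi0 : forall j, 'd (phi j) (0 : 'rV[R]_5) = 0 :> (_ -> _))
    (M_generic : forall p, U p -> CR_generic phi p)
    (Lbar_gen : T01_generator phi U Lbar)
    (M_maxmin : maximally_minimal Lbar U) :
  let L := Lfield Lbar in
  let T := Tfield Lbar in
  let S := Sfield Lbar in
  let Sbar := Sbarfield Lbar in
  (exists P Q Rc A B C : 'rV[R]_5 -> R[i],
    (forall p, U p ->
      [/\ bracket L S p = P p *: T p + Q p *: S p + Rc p *: Sbar p,
          bracket Lbar S p = A p *: T p + B p *: S p + C p *: Sbar p,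
          bracket L Sbar p =
            (A p)^*%C *: T p + (C p)^*%C *: S p + (B p)^*%C *: Sbar p
        & bracket Lbar Sbar p =
            (P p)^*%C *: T p + (Rc p)^*%C *: S p + (Q p)^*%C *: Sbar p]) /\
    (forall p, U p ->
      [/\ bracket Lbar S p = bracket L Sbar p,
          conjf (bracket Lbar S) p = bracket Lbar S p
        & conjf (bracket L Sbar) p = bracket L Sbar p]) /\
    (forall p, U p -> complex.Im (A p) = 0 /\ C p = (B p)^*%C)).
Proof.
move=> L T S Sbar.
have sLbar := smoothv_generator U_open phi_analytic Lbar_gen.
have Lxy p : U p -> Lbar p 0 xix = 2^-1 /\ Lbar p 0 yix = 'i%C / 2.
  by case/Lbar_gen.
have cLbar : xy_constant U Lbar by exists 2^-1, ('i%C / 2).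
have cL : xy_constant U L.
  by exists 2^-1, (- ('i%C / 2)); exact: Lfield_xy.
have cS : xy_constant U S.
  by apply: vertical_xy_constant; exact: vertical_Sfield.
(* Conjugation fixes [T] and exchanges [S] with [Sbar], so the last two coefficients are conjugated
   and swapped. *)
have conj_comb V p a b c : U p -> V p = a *: T p + b *: S p + c *: Sbar p ->
    conjf V p = a^*%C *: T p + c^*%C *: S p + b^*%C *: Sbar p.
  move=> Up e; apply/rowP => k.
  have E (X : vfield R 5) : conjf X p 0 k = (X p 0 k)^*%C by rewrite mxE.
  have eT : (T p 0 k)^*%C = T p 0 k by rewrite -E (conjf_Tfield U_open sLbar Up).
  have eS : (S p 0 k)^*%C = Sbar p 0 k by rewrite -E (conjf_Sfield U_open sLbar Up).
  have eSb : (Sbar p 0 k)^*%C = S p 0 k.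
    by rewrite -E (conjf_Sbarfield U_open sLbar Up).
  rewrite E e; move: (T p) (S p) (Sbar p) eT eS eSb => t s sb eT eS eSb.
  by rewrite !mxE !rmorphD !rmorphM /= eT eS eSb addrAC.
have [P [Q [Rc hLS]]] := vertical_combination U_open M_maxmin Lxy
  (vertical_bracket U_open cL cS).
have [A [B [C hLbS]]] := vertical_combination U_open M_maxmin Lxy
  (vertical_bracket U_open cLbar cS).
have hLSb p (Up : U p) : bracket L Sbar p =
    (A p)^*%C *: T p + (C p)^*%C *: S p + (B p)^*%C *: Sbar p.
  rewrite -(conjf_bracket_LbarS U_open sLbar Up).
  exact: conj_comb (hLbS p Up).
have eqb p (Up : U p) := bracket_LbarS U_open sLbar Up.
exists P, Q, Rc, A, B, C; split; [|split] => p Up.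
- split; [exact: hLS|exact: hLbS|exact: hLSb|].
  rewrite -(conjf_bracket_LS U_open sLbar Up).
  exact: conj_comb (hLS p Up).
- have eL := conjf_bracket_LbarS U_open sLbar Up.
  split; [exact: (eqb p Up)|exact: etrans eL (esym (eqb p Up))|].
  rewrite -(eqb p Up); apply/rowP => k.
  rewrite [LHS]mxE -eL [conjf _ p 0 k]mxE; exact: conjcK.
(* One vector now has the coefficients $(A,B,C)$ and $(\overline A,\overline C,\overline B)$. By
   uniqueness $A=\overline A$ and $C=\overline B$; the middle equality is the conjugate of the
   last. *)
- have := eqb p Up; rewrite hLbS// hLSb// => e.
  have [ea _ ec] := vertical_combination_unique M_maxmin Up e.
  split=> //; have := congr1 (@complex.Im R) ea; rewrite Im_conjc.
  by move/eqP; rewrite -addr_eq0 -mulr2n mulrn_eq0 /= => /eqP.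
Qed.
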